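(* Let $R$ be a valuation ring, $M$ its maximal ideal and $Z$ the set of zero divisors of $R$. Then: (1) if $Z=0$, $R$ is coherent; (2) if $Z\neq 0$ and $Z\neq M$, then $\lambda\text{-}\dim(R)=2$; (3) if $Z\neq0$ and $Z=M$, then $\lambda\text{-}\dim(R)\le 2$; (4) if $R$ is a domain or a noncoherent ring, then $M$ is a flat ideal and every $R$-module $E$ with $\lambda_R(E)=\infty$ has flat dimension at most $1$.
   Context: All rings are commutative with identity. A valuation ring is a ring whose ideals are totally ordered by inclusion. For an $R$-module $E$, $\lambda_R(E)$ is the supremum of the $n$ for which there is an exact sequence $F_n\to\cdots\to F_0\to E\to0$ with $F_i$ free of finite rank ($-1$ if $E$ is not finitely generated); $\lambda\text{-}\dim(R)$ is the least $n$ (or $\infty$) such that $\lambda_R(E)\ge n$ implies $\lambda_R(E)=\infty$ for all $R$-modules $E$. The flat dimension of $E$ is the least $n$ with $\mathrm{Tor}^R_{n+1}(F,E)=0$ for all $R$-modules $F$. *)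

(* Defs.v *)
From HB Require Import structures.
From mathcomp Require Import all_boot all_order all_algebra.
Set Implicit Arguments. Unset Strict Implicit. Unset Printing Implicit Defensive.
Import GRing.Theory.
Local Open Scope ring_scope.

Definition is_ideal {R : comNzRingType} (I : R -> Prop) : Prop :=
  I 0 /\ (forall x y, I x -> I y -> I (x + y)) /\ (forall r x, I x -> I (r * x)).

Definition valuation_ring (R : comNzRingType) : Prop :=
  forall I J : R -> Prop, is_ideal I -> is_ideal J ->
    (forall x, I x -> J x) \/ (forall x, J x -> I x).

Definition maximal_ideal {R : comNzRingType} (M : R -> Prop) : Prop :=
  is_ideal M /\ ~ M 1 /\
  forall J : R -> Prop, is_ideal J -> (forall x, M x -> J x) ->
    (forall x, J x <-> M x) \/ J 1.

Definition zero_divisor {R : comNzRingType} (a : R) : Prop :=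
  exists b : R, b != 0 /\ a * b = 0.

Definition is_domain (R : comNzRingType) : Prop :=
  forall a b : R, a * b = 0 -> a = 0 \/ b = 0.

Definition lin {R : comNzRingType} {A B : lmodType R} (f : A -> B) : Prop :=
  forall (a : R) (x y : A), f (a *: x + y) = a *: f x + f y.

Definition bilin {R : comNzRingType} {A B C : lmodType R} (h : A -> B -> C) : Prop :=
  (forall x, lin (h x)) /\ (forall y, lin (fun x => h x y)).

Definition exact_at {R : comNzRingType} {A B C : lmodType R}
  (f : A -> B) (g : B -> C) : Prop :=
  forall y : B, g y = 0 <-> exists x : A, f x = y.

Definition is_basis {R : comNzRingType} {L : lmodType R} {I : Type} (e : I -> L) : Prop :=
  (forall x : L, exists (n : nat) (g : 'I_n -> I) (c : 'I_n -> R),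
      x = \sum_(k < n) c k *: e (g k)) /\
  (forall (n : nat) (g : 'I_n -> I) (c : 'I_n -> R), injective g ->
      \sum_(k < n) c k *: e (g k) = 0 -> forall k, c k = 0).

Definition is_free {R : comNzRingType} (L : lmodType R) : Prop :=
  exists (I : Type) (e : I -> L), is_basis e.

Definition free_finite_rank {R : comNzRingType} (L : lmodType R) : Prop :=
  exists (k : nat) (e : 'I_k -> L), is_basis e.

(* lambda_R(E) >= n : there is an exact sequence
   F_n -> ... -> F_1 -> F_0 -> E -> 0 with F_i free of finite rank
   (d i : F_(i+1) -> F_i; the F_i for i > n are irrelevant). *)
Definition lambda_ge {R : comNzRingType} (E : lmodType R) (n : nat) : Prop :=
  exists (F : nat -> lmodType R) (d : forall i, F i.+1 -> F i) (eps : F 0%N -> E),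
    (forall i, (i <= n)%N -> free_finite_rank (F i)) /\
    (forall i, lin (d i)) /\ lin eps /\
    (forall y : E, exists x, eps x = y) /\
    ((0 < n)%N -> exact_at (d 0%N) eps) /\
    (forall i, (i.+1 < n)%N -> exact_at (d i.+1) (d i)).

Definition lambda_infinite {R : comNzRingType} (E : lmodType R) : Prop :=
  forall n, lambda_ge E n.

Definition lambda_dim_prop (R : comNzRingType) (n : nat) : Prop :=
  forall E : lmodType R, lambda_ge E n -> lambda_infinite E.

Definition lambda_dim_eq (R : comNzRingType) (n : nat) : Prop :=
  lambda_dim_prop R n /\ forall m, (m < n)%N -> ~ lambda_dim_prop R m.

Definition lambda_dim_le (R : comNzRingType) (n : nat) : Prop :=
  exists m, (m <= n)%N /\ lambda_dim_prop R m.

(* R is coherent: every finitely generated ideal is finitely presented.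
   An ideal is represented as a module N with an injective linear map into R. *)
Definition coherent (R : comNzRingType) : Prop :=
  forall (N : lmodType R) (j : N -> R^o), lin j -> injective j ->
    lambda_ge N 0 -> lambda_ge N 1.

Definition is_tensor {R : comNzRingType} {A B T : lmodType R} (b : A -> B -> T) : Prop :=
  bilin b /\
  forall (W : lmodType R) (h : A -> B -> W), bilin h ->
    (exists u : T -> W, lin u /\ forall x y, u (b x y) = h x y) /\
    (forall u1 u2 : T -> W, lin u1 -> lin u2 ->
       (forall x y, u1 (b x y) = h x y) -> (forall x y, u2 (b x y) = h x y) ->
       forall t, u1 t = u2 t).

Definition flat {R : comNzRingType} (N : lmodType R) : Prop :=
  forall (A B : lmodType R) (f : A -> B), lin f -> injective f ->
  forall (TA TB : lmodType R) (bA : A -> N -> TA) (bB : B -> N -> TB),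
    is_tensor bA -> is_tensor bB ->
  forall g : TA -> TB, lin g -> (forall a x, g (bA a x) = bB (f a) x) ->
    injective g.

Definition flat_ideal {R : comNzRingType} (M : R -> Prop) : Prop :=
  forall (N : lmodType R) (j : N -> R^o), lin j -> injective j ->
    (forall r : R, M r <-> exists x, j x = r) -> flat N.

(* Tor^R_(k+1)(F, E) = 0, computed from any free (hence projective) resolution
   ... -> L_1 -> L_0 -> E -> 0 of E: the complex F (x) L_. is exact at
   F (x) L_(k+1). *)
Definition tor_succ_vanish {R : comNzRingType} (k : nat) (F E : lmodType R) : Prop :=
  forall (L : nat -> lmodType R) (d : forall i, L i.+1 -> L i) (eps : L 0%N -> E),
    (forall i, is_free (L i)) -> (forall i, lin (d i)) -> lin eps ->
    (forall y : E, exists x, eps x = y) -> exact_at (d 0%N) eps ->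
    (forall i, exact_at (d i.+1) (d i)) ->
  forall (T : nat -> lmodType R) (b : forall i, F -> L i -> T i),
    (forall i, is_tensor (b i)) ->
  forall t : forall i, T i.+1 -> T i,
    (forall i, lin (t i)) -> (forall i x y, t i (b i.+1 x y) = b i x (d i y)) ->
    exact_at (t k.+1) (t k).

Definition flat_dim_le {R : comNzRingType} (E : lmodType R) (n : nat) : Prop :=
  exists m, (m <= n)%N /\ forall F : lmodType R, tor_succ_vanish m F E.

(* Main.v *)
Require Import Defs.
From HB Require Import structures.
From mathcomp Require Import all_boot all_order all_algebra.
From mathcomp Require Import perm boolp functions.
From mathcomp Require Import ring.
Set Implicit Arguments. Unset Strict Implicit. Unset Printing Implicit Defensive.
Import GRing.Theory.
Local Open Scope ring_scope.
Local Open Scope quotient_scope.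

(* Every principal annihilator ideal is reflexive: if [(0:a) = bR] with [a] and [b]
   nonzero, then [(0:b) = aR]. Over a valuation ring every matrix is equivalent to
   a diagonal one, so a finitely presented module is a direct sum of modules [R/a_i],
   and [lambda >= 2] says that each [(0:a_i)] is principal; iterating annihilators
   then yields an infinite resolution by diagonal matrices, so [lambda-dim R <= 2].
   If some regular [s] lies in [M], then by Nakayama a principal [(0:a)] with
   [a <> 0] vanishes, so [R/a] has [lambda = 1] for any nonzero zero divisor [a].
   One nonzero [a] with [(0:a)] principal and nonzero makes all annihilators
   principal, hence [R] coherent. In a domain or a noncoherent ring, [lambda >= 2]
   therefore forces every [a_i] to be zero or regular, and the module has
   projective dimension at most 1. Flatness of [M] follows from the equational
   criterion: if [z y = 0] with [z <> 0] and [y <> 0] in [M], then [yR] is not all of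
   [(0:z)], so [y = t y'] with [z t = 0] and [y'] in [M]. *)

(** * Divisibility and principal annihilators in a valuation ring *)

Definition divides {R : comNzRingType} (a b : R) : Prop := exists r, b = a * r.

Definition ann_gen {R : comNzRingType} (a b : R) : Prop :=
  forall x, a * x = 0 <-> divides b x.

Definition regular {R : comNzRingType} (a : R) : Prop := forall x, a * x = 0 -> x = 0.

Section ValuationRing.
Variable R : comNzRingType.
Hypothesis valR : valuation_ring R.
Implicit Types a b c x y z : R.

Lemma is_ideal_divides a : is_ideal (divides a).
Proof.
split; first by exists 0; rewrite mulr0.
split=> [x y [r ->] [s ->]|r x [s ->]].
  by exists (r + s); rewrite mulrDr.
by exists (r * s); rewrite mulrCA.
Qed.

Lemma divides_total a b : divides a b \/ divides b a.
Proof.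
have dd c : divides c c by exists 1; rewrite mulr1.
case: (valR (is_ideal_divides a) (is_ideal_divides b)) => h.
  by right; apply: h.
by left; apply: h.
Qed.

Lemma divides_trans b a c : divides a b -> divides b c -> divides a c.
Proof. by case=> r -> [s ->]; exists (r * s); rewrite mulrA. Qed.

Lemma common_divisor (I : Type) (F : I -> R) (s : seq I) : s <> [::] ->
  exists i, forall j, List.In j s -> divides (F i) (F j).
Proof.
elim: s => // i s IH _; case: (pselect (s = [::])) => [->|/IH [k hk]].
  by exists i => j [<-|//]; exists 1; rewrite mulr1.
case: (divides_total (F i) (F k)) => h.
  exists i => j [<-|/hk]; first by exists 1; rewrite mulr1.
  exact: divides_trans.
by exists k => j [<-|/hk].
Qed.

Lemma common_divisor_fin (I : finType) (F : I -> R) (i0 : I) :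
  exists i, forall j, divides (F i) (F j).
Proof.
have ne : enum I <> [::] by move=> e; move: (mem_enum I i0); rewrite e.
have [i hi] := common_divisor F ne; exists i => j; apply: hi.
have : j \in enum I by rewrite mem_enum.
by elim: (enum I) => //= k s IH; rewrite inE => /orP[/eqP ->|/IH]; [left|right].
Qed.

Variable M : R -> Prop.
Hypothesis maxM : maximal_ideal M.

(** Since x lies in xR but not in M, total ordering puts M inside xR, and maximality then forces 1
    into xR. *)
Lemma nonunit_maximal x : ~ M x -> exists y, x * y = 1.
Proof.
case: maxM => idM [M1 maxi] nMx.
have sM : forall y, M y -> divides x y.
  case: (valR (is_ideal_divides x) idM) => // h.
  by case: nMx; apply: h; exists 1; rewrite mulr1.
case: (maxi _ (is_ideal_divides x) sM) => [h|[y ->]]; last by exists y.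
by case: nMx; apply/h; exists 1; rewrite mulr1.
Qed.

(* Nakayama's lemma for a principal ideal. *)
Lemma maximal_fixed_eq0 s z x : M s -> x = s * (x * z) -> x = 0.
Proof.
case: maxM => [[M0 [MD MM]] [M1 _]] Ms e.
have [|y hy] := @nonunit_maximal (1 - s * z).
  move=> h; apply: M1; have -> : 1 = (1 - s * z) + z * s by ring.
  by apply: MD => //; apply: MM.
have : x * (1 - s * z) = 0 by rewrite mulrBr mulr1 {1}e; ring.
by move/(congr1 (fun t => t * y)); rewrite -mulrA hy mulr1 mul0r.
Qed.

(** If b = s y, then s (a y) = 0, so y = b z and b = s b z vanishes by Nakayama. If s = b y, then s
    a = 0, against a being nonzero. *)
Lemma regular_ann_gen a b s : M s -> regular s -> ann_gen a b -> a != 0 -> regular a.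
Proof.
move=> Ms rs ab a0.
have b0 : a * b = 0 by apply/ab; exists 1; rewrite mulr1.
suff bz : b = 0 by move=> x /ab [y ->]; rewrite bz mul0r.
case: (divides_total s b) => [[y e]|[y e]].
  have /ab [z ez] : a * y = 0 by apply: rs; rewrite mulrCA -e.
  by apply: (@maximal_fixed_eq0 s z) => //; rewrite -ez.
have /rs a0' : s * a = 0 by rewrite e mulrAC [b * a]mulrC b0 mul0r.
by rewrite a0' eqxx in a0.
Qed.

(** Let b c = 0 and a = c r. A unit r makes c a multiple of a, and a regular r in M would make a
    regular, hence b = 0. Otherwise r t = 0 with t nonzero, and comparing c with t forces t or a to
    vanish. *)
Lemma ann_gen_sym a b : ann_gen a b -> a != 0 -> b != 0 -> ann_gen b a.
Proof.
move=> ab a0 b0 c.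
have ab0 : a * b = 0 by apply/ab; exists 1; rewrite mulr1.
split=> [bc|[y ->]]; last by rewrite mulrA [b * a]mulrC ab0 mul0r.
case: (divides_total a c) => // -[r ar].
case: (pselect (M r)) => [Mr|/nonunit_maximal [y ry]]; last first.
  by exists y; rewrite ar -mulrA ry mulr1.
case: (pselect (regular r)) => [rr|nr].
  have ra : regular a by apply: (regular_ann_gen Mr rr ab).
  by move/ra: ab0 => bz; rewrite bz eqxx in b0.
have [t [rt t0]] : exists t, r * t = 0 /\ t <> 0.
  by apply: contrapT => h; apply: nr => t rt; apply: contrapT => t0; apply: h; exists t.
case: (divides_total c t) => -[u e].
  have /ab [w ew] : a * u = 0 by rewrite ar mulrAC -e mulrC.
  by case: t0; rewrite e ew mulrA [c * b]mulrC bc mul0r.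
by move: a0; rewrite ar e mulrAC [t * r]mulrC rt mul0r eqxx.
Qed.

(** Outside the symmetric case: a = 0 makes b a unit, with annihilator 0, and b = 0 has annihilator
    R. *)
Lemma ann_gen_next a b : ann_gen a b -> exists c, ann_gen b c.
Proof.
move=> ab; case: (eqVneq a 0) => [a0|a0].
  have /ab [y e] : a * 1 = 0 by rewrite a0 mul0r.
  exists 0 => x; split=> [bx|[z ->]]; last by rewrite mul0r mulr0.
  by exists 0; rewrite mulr0 -[x]mul1r e mulrAC bx mul0r.
case: (eqVneq b 0) => [->|b0]; last by exists a; apply: ann_gen_sym.
by exists 1 => x; split=> [_|]; [exists x; rewrite mul1r|rewrite mul0r].
Qed.

(** Write c = a r. As c is nonzero, b does not divide r, so b = r s, and s is the generator. *)
Lemma ann_gen_multiple a b c : ann_gen a b -> b != 0 -> c != 0 ->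
  divides a c -> exists d, ann_gen c d.
Proof.
move=> ab b0 c0 [r e].
have ab0 : a * b = 0 by apply/ab; exists 1; rewrite mulr1.
case: (divides_total b r) => -[s es].
  by move: c0; rewrite e es mulrA ab0 mul0r eqxx.
exists s => x; split=> [cx|[v ->]]; last first.
  by rewrite e mulrA -[a * r * s]mulrA -es ab0 mul0r.
have /ab [y ey] : a * (r * x) = 0 by rewrite mulrA -e.
have rw : r * (x - s * y) = 0 by rewrite mulrBr mulrA -es ey subrr.
(* If s were a multiple of x - s y, which r kills, then b = r s would be 0. *)
case: (divides_total s (x - s * y)) => -[v ev].
  by exists (y + v); rewrite mulrDr -ev addrC subrK.
by move: b0; rewrite es ev mulrA rw mul0r eqxx.
Qed.

(** If a is a multiple of c, then (0:c) lies in (0:a) = bR, so it equals b (0:bc); and bc is a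
    multiple of b, whose annihilator is aR. *)
Lemma ann_gen_all a b : ann_gen a b -> a != 0 -> b != 0 ->
  forall c, exists d, ann_gen c d.
Proof.
move=> ab a0 b0 c.
have ba := ann_gen_sym ab a0 b0.
case: (eqVneq c 0) => [->|c0].
  by exists 1 => x; split=> [_|]; [exists x; rewrite mul1r|rewrite mul0r].
case: (divides_total a c) => [|[r e]]; first exact: ann_gen_multiple.
have sub x : c * x = 0 -> divides b x.
  by move=> cx; apply/ab; rewrite e mulrAC cx mul0r.
case: (eqVneq (b * c) 0) => [bc|bc].
  exists b => x; split=> [/sub //|[y ->]].
  by rewrite mulrA [c * b]mulrC bc mul0r.
have [|s hs] := ann_gen_multiple ba a0 bc; first by exists c.
exists (b * s) => x; split=> [cx|[w ->]].
  have [y ey] := sub _ cx.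
  have /hs [w ew] : b * c * y = 0 by rewrite mulrAC -ey mulrC.
  by exists w; rewrite ey ew mulrA.
have : b * c * s = 0 by apply/hs; exists 1; rewrite mulr1.
by rewrite !mulrA [c * b]mulrC => ->; rewrite mul0r.
Qed.
End ValuationRing.

(** * Linear maps *)

Section LinearMaps.
Variable R : comNzRingType.
Implicit Types A B C : lmodType R.

Lemma linD A B (f : A -> B) : lin f -> forall x y, f (x + y) = f x + f y.
Proof. by move=> h x y; have := h 1 x y; rewrite !scale1r. Qed.

Lemma lin0 A B (f : A -> B) : lin f -> f 0 = 0.
Proof. by move=> h; apply: (addrI (f 0)); rewrite -linD // !addr0. Qed.

Lemma linZ A B (f : A -> B) : lin f -> forall a x, f (a *: x) = a *: f x.
Proof. by move=> h a x; rewrite -[a *: x]addr0 h lin0 // addr0. Qed.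

Lemma linB A B (f : A -> B) : lin f -> forall x y, f (x - y) = f x - f y.
Proof. by move=> h x y; rewrite linD // -scaleN1r linZ // scaleN1r. Qed.

Lemma lin_sum A B (f : A -> B) : lin f -> forall (I : Type) (s : seq I) (P : pred I) (F : I -> A),
  f (\sum_(i <- s | P i) F i) = \sum_(i <- s | P i) f (F i).
Proof. by move=> h I s P F; apply: (big_morph f (linD h) (lin0 h)). Qed.

Lemma lin_id A : lin (fun x : A => x).
Proof. by []. Qed.

Lemma lin_zero A B : lin (fun _ : A => 0 : B).
Proof. by move=> a x y; rewrite scaler0 addr0. Qed.

Lemma lin_comp A B C (f : B -> C) (g : A -> B) : lin f -> lin g -> lin (fun x => f (g x)).
Proof. by move=> hf hg a x y; rewrite hg hf. Qed.

Lemma lin_add A B (f g : A -> B) : lin f -> lin g -> lin (fun x => f x + g x).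
Proof. by move=> hf hg a x y; rewrite hf hg scalerDr addrACA. Qed.

Lemma lin_sub A B (f g : A -> B) : lin f -> lin g -> lin (fun x => f x - g x).
Proof. by move=> hf hg a x y; rewrite hf hg scalerBr opprD addrACA. Qed.

Lemma lin_row_mulmx m n (D : 'M[R]_(m, n)) : lin (fun x : 'rV[R]_m => x *m D).
Proof. by move=> a x y; rewrite mulmxDl scalemxAl. Qed.

Lemma bij_lin_inverse A B (u : A -> B) : lin u -> injective u ->
  (forall y, exists x, u x = y) ->
  exists v : B -> A, [/\ lin v, forall x, v (u x) = x & forall y, u (v y) = y].
Proof.
move=> ul ui us; have [v hv] := choice us.
exists v; split=> // [a x y|x]; apply: ui; by rewrite ?ul !hv.
Qed.

End LinearMaps.

(** * Quotient modules *)

Definition submodule {R : comNzRingType} {V : lmodType R} (S : V -> Prop) : Prop :=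
  [/\ S 0, forall x y, S x -> S y -> S (x + y) & forall a x, S x -> S (a *: x)].

Section Quotient.
Variables (R : comNzRingType) (V : lmodType R) (S : V -> Prop).
Hypothesis hS : submodule S.

Let equiv (x y : V) := `[< S (x - y) >].

Let equiv_is_equiv : equiv_class_of equiv.
Proof.
case: hS => S0 SD SZ.
have SN x : S x -> S (- x) by rewrite -scaleN1r; apply: SZ.
split=> [x|x y|y x z]; first by apply/asboolP; rewrite subrr.
  by apply/asboolP/asboolP => /SN; rewrite opprB.
move=> /asboolP xy /asboolP yz; apply/asboolP.
by rewrite -(subrK y x) -addrA; apply: SD.
Qed.

Let equiv_canonical := EquivRelPack equiv_is_equiv.
Canonical equiv_canonical.
Let Q : Type := {eq_quot equiv}.
HB.instance Definition _ := Choice.on Q.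
HB.instance Definition _ : EqQuotient V equiv Q := EqQuotient.on Q.
Let p (x : V) : Q := \pi_Q x.
Let r (x : Q) : V := repr x.

Let prK x : p (r x) = x.
Proof. exact: reprK. Qed.

Let p_eq x y : p x = p y <-> S (x - y).
Proof.
split=> [/eqP|h]; last apply/eqP; first by rewrite piE => /asboolP.
by rewrite piE; apply/asboolP.
Qed.

Let p_rDl x y : p (r (p x) + y) = p (x + y).
Proof. by apply/p_eq; rewrite opprD addrACA subrr addr0; apply/p_eq; rewrite prK. Qed.

Let p_rDr x y : p (x + r (p y)) = p (x + y).
Proof. by rewrite addrC p_rDl addrC. Qed.

Let p_rZ a x : p (a *: r (p x)) = p (a *: x).
Proof.
by case: hS => _ _ SZ; apply/p_eq; rewrite -scalerBr; apply: SZ; apply/p_eq; rewrite prK.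
Qed.

Let p_rE := (p_rDl, p_rDr, p_rZ).

Let add (x y : Q) : Q := p (r x + r y).
(** Negation is scaling by -1, so that [p_rZ] also carries it through representatives. *)
Let opp (x : Q) : Q := p (-1 *: r x).
Let scale (a : R) (x : Q) : Q := p (a *: r x).

Let addA : associative add.
Proof. by move=> x y z; rewrite /add !p_rE addrA. Qed.

Let addC : commutative add.
Proof. by move=> x y; rewrite /add addrC. Qed.

Let add0 : left_id (p 0) add.
Proof. by move=> x; rewrite /add p_rE add0r prK. Qed.

Let addN : left_inverse (p 0) opp add.
Proof. by move=> x; rewrite /add /opp p_rE scaleN1r addNr. Qed.

HB.instance Definition _ := GRing.isZmodule.Build Q addA addC add0 addN.

Let scaleA a b v : scale a (scale b v) = scale (a * b) v.
Proof. by rewrite /scale p_rE scalerA. Qed.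

Let scale1 : left_id 1 scale.
Proof. by move=> v; rewrite /scale scale1r prK. Qed.

Let scaleDr : right_distributive scale +%R.
Proof.
move=> a x y; rewrite /GRing.add /= /scale /add !p_rE.
by rewrite scalerDr.
Qed.

Let scaleDl v : {morph scale^~ v : a b / a + b}.
Proof.
move=> a b; rewrite [RHS]/GRing.add /= /scale /add !p_rE.
by rewrite scalerDl.
Qed.

HB.instance Definition _ :=
  GRing.Zmodule_isLmodule.Build R Q scaleA scale1 scaleDr scaleDl.

Lemma quotient_module : exists (W : lmodType R) (q : V -> W),
  [/\ lin q, forall w, exists v, q v = w & forall v, q v = 0 <-> S v].
Proof.
exists (Q : lmodType R), p; split=> [a x y|w|v].
- change (p (a *: x + y) = add (scale a (p x)) (p y)); by rewrite /add /scale p_rDr p_rZ p_rDl.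
- by exists (r w); rewrite prK.
- by rewrite -{2}(subr0 v); apply: p_eq.
Qed.
End Quotient.

(** * Free modules: coordinates and lifting *)

Section Free.
Variable R : comNzRingType.

Lemma free_finite_rank_rV n : @free_finite_rank R 'rV[R]_n.
Proof.
exists n, (fun i => delta_mx 0 i); split=> [x|k g c gi].
  by exists n, id, (fun i => x 0 i); rewrite [LHS]row_sum_delta.
move=> h i; move/rowP: h => /(_ (g i)).
rewrite summxE mxE (bigD1 i) //= !mxE !eqxx mulr1 big1 ?addr0 // => j ji.
by rewrite !mxE (inj_eq gi) eq_sym (negPf ji) andbF mulr0.
Qed.

Lemma free_finite_rank_free (L : lmodType R) : free_finite_rank L -> is_free L.
Proof. by case=> k [e he]; exists 'I_k, e. Qed.

Lemma free_coordinates (L : lmodType R) : free_finite_rank L ->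
  exists k (u : 'rV[R]_k -> L), [/\ lin u, injective u & forall y, exists x, u x = y].
Proof.
case=> k [e [sp fr]].
have ul : lin (fun x : 'rV[R]_k => \sum_i x 0 i *: e i).
  move=> a x y; rewrite scaler_sumr -big_split; apply: eq_bigr => i _ /=.
  by rewrite !mxE scalerDl scalerA.
exists k, (fun x : 'rV[R]_k => \sum_i x 0 i *: e i); split=> // [x y exy|y].
  apply/rowP => i; apply/eqP; rewrite -subr_eq0; apply/eqP.
  have := fr k id (fun i => x 0 i - y 0 i) (fun _ _ h => h); apply.
  under eq_bigr do rewrite scalerBl.
  by rewrite sumrB exy subrr.
have [n [g [c ->]]] := sp y.
exists (\sum_j c j *: delta_mx 0 (g j)); rewrite (lin_sum ul).
apply: eq_bigr => j _; rewrite (linZ ul) (bigD1 (g j)) //= big1 => [|i ne].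
  by rewrite mxE !eqxx scale1r addr0.
by rewrite mxE (negPf ne) andbF scale0r.
Qed.

(** Projectivity of free modules. Independence is stated for injective families of indices, so
    combinations are handled as lists of coefficient-index pairs and grouped by index before it is
    applied. *)
Lemma free_lift (L A B : lmodType R) (u : L -> B) (p : A -> B) :
  is_free L -> lin u -> lin p -> (forall x, exists a, p a = u x) ->
  exists v : L -> A, lin v /\ forall x, p (v x) = u x.
Proof.
case=> I [e [sp fr]] ul pl hp.
pose J : choiceType := Choice.Pack (Choice.Class (gen_choiceMixin I) (gen_eqMixin I)).
have [w hw] := choice (fun i => hp (e i)).
pose comb (W : lmodType R) (f : J -> W) (s : seq (R * J)) := \sum_(q <- s) q.1 *: f q.2.
(* Replacing [e] by [w] preserves vanishing combinations: once equal indices are grouped,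
   independence kills every coefficient. *)
have welldef (s : seq (R * J)) : comb L e s = 0 -> comb A w s = 0.
  pose s' := undup [seq q.2 | q <- s].
  have us : uniq s' by apply: undup_uniq.
  have grp (W : lmodType R) (f : J -> W) : comb W f s =
      \sum_(j < size s') (\sum_(q <- s | q.2 == tnth (in_tuple s') j) q.1)
        *: f (tnth (in_tuple s') j).
    rewrite -(big_tnth _ _ s' xpredT (fun j => (\sum_(q <- s | q.2 == j) q.1) *: f j)).
    under [RHS]eq_bigr do rewrite scaler_suml.
    rewrite (exchange_big_dep xpredT) //=; apply: eq_big_seq => q qs.
    have qs' : q.2 \in s' by rewrite mem_undup map_f.
    rewrite big_mkcond (bigD1_seq q.2) //= eqxx big1 ?addr0 // => j ne.
    by rewrite eq_sym (negPf ne).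
  have tinj : injective (tnth (in_tuple s')) by apply/tuple_uniqP.
  rewrite grp => /(fr _ _ _ tinj) h; rewrite grp big1 // => j _.
  by rewrite h scale0r.
have rep x : exists s, x = comb L e s.
  have [n [g [c ->]]] := sp x; exists [seq (c k, g k) | k <- enum 'I_n].
  by rewrite /comb big_map big_enum.
have {rep} [t ht] := choice rep.
exists (fun x => comb A w (t x)); split=> [a x y|x]; last first.
  rewrite {2}(ht x) /comb !lin_sum //; apply: eq_bigr => q _.
  by rewrite !linZ // hw.
(* This list represents the defect of linearity; its value in [L] is 0, hence so is its value in
   [A]. *)
pose s := t (a *: x + y) ++ [seq (- a * q.1, q.2) | q <- t x] ++ [seq (- q.1, q.2) | q <- t y].
have combs (W : lmodType R) (f : J -> W) :
    comb W f s = comb W f (t (a *: x + y)) - (a *: comb W f (t x) + comb W f (t y)).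
  rewrite /comb !big_cat !big_map /= opprD -scaleNr scaler_sumr -sumrN.
  by congr (_ + (_ + _)); apply: eq_bigr => q _; rewrite ?scalerA ?scaleNr.
apply/eqP; rewrite -subr_eq0 -combs; apply/eqP/welldef.
by rewrite combs -!ht subrr.
Qed.
End Free.

(** * Tensor products and the vanishing of Tor *)

Section Tor.
Variable R : comNzRingType.

Lemma tensor_map (F L L' T T' : lmodType R) (b : F -> L -> T) (b' : F -> L' -> T')
    (f : L -> L') : is_tensor b -> is_tensor b' -> lin f ->
  exists g : T -> T', lin g /\ forall x y, g (b x y) = b' x (f y).
Proof.
move=> [_ ub] [[b'l b'r] _] fl; apply: (ub _ (fun x y => b' x (f y)) _).1.
by split=> [x|y]; [apply: lin_comp (b'l x) fl|apply: b'r].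
Qed.

Lemma tensor_ext (F L T W : lmodType R) (b : F -> L -> T) (u v : T -> W) :
  is_tensor b -> lin u -> lin v -> (forall x y, u (b x y) = v (b x y)) -> forall t, u t = v t.
Proof.
move=> [[bl br] ub] ul vl uv.
have hb : bilin (fun x y => v (b x y)).
  by split=> [x|y]; [apply: lin_comp vl (bl x)|apply: lin_comp vl (br y)].
by apply: (ub _ _ hb).2.
Qed.

(* The comparison maps between [L] and the given presentation are homotopic to
   the identity; projecting by [q] makes the one from [L 1] kill the image of
   [d 1], so that the homotopy contracts [L] at [L 2]. *)
Lemma tor2_vanish (E F0 F1 : lmodType R) (d : F1 -> F0) (eps : F0 -> E) (q : F1 -> F1) :
  is_free F0 -> is_free F1 -> lin d -> lin eps -> lin q ->
  (forall y, exists x, eps x = y) -> exact_at d eps ->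
  (forall x, d (q x) = d x) -> (forall x, d x = 0 -> q x = 0) ->
  forall F, tor_succ_vanish 1 F E.
Proof.
move=> fF0 fF1 dl el ql es ex dq qd F L dL eL fL dLl eLl eLs ex0 exS T b tb t tl tb'.
have dd0 x : eL (dL 0%N x) = 0 by apply/ex0; exists x.
have ddS i x : dL i (dL i.+1 x) = 0 by apply/exS; exists x.
have [g0 [g0l g0E]] := free_lift (fL 0%N) eLl el (fun x => es (eL x)).
have lift_g1 x : exists y, d y = g0 (dL 0%N x) by apply/ex; rewrite g0E dd0.
have [g1 [g1l g1E]] := free_lift (fL 1%N) (lin_comp g0l (dLl 0%N)) dl lift_g1.
have [f0 [f0l f0E]] := free_lift fF0 el eLl (fun x => eLs (eps x)).
have lift_f1 x : exists y, dL 0%N y = f0 (d x).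
  by apply/ex0; rewrite f0E; apply/ex; exists x.
have [f1 [f1l f1E]] := free_lift fF1 (lin_comp f0l dl) (dLl 0%N) lift_f1.
have qg1 x : q (g1 (dL 1%N x)) = 0 by apply: qd; rewrite g1E ddS (lin0 g0l).
have l0 := lin_sub (@lin_id R (L 0%N)) (lin_comp f0l g0l).
have lift_h0 x : exists y, dL 0%N y = x - f0 (g0 x).
  by apply/ex0; rewrite (linB eLl) f0E g0E subrr.
have [h0 [h0l h0E]] := free_lift (fL 0%N) l0 (dLl 0%N) lift_h0.
have l1 := lin_sub (lin_sub (@lin_id R (L 1%N)) (lin_comp f1l (lin_comp ql g1l)))
  (lin_comp h0l (dLl 0%N)).
have lift_h1 x : exists y, dL 1%N y = x - f1 (q (g1 x)) - h0 (dL 0%N x).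
  apply/exS; rewrite !(linB (dLl 0%N)) f1E dq g1E h0E.
  by rewrite opprB addrC subrKA subrr.
have [h1 [h1l h1E]] := free_lift (fL 1%N) l1 (dLl 1%N) lift_h1.
have l2 := lin_sub (@lin_id R (L 2%N)) (lin_comp h1l (dLl 1%N)).
have lift_h2 x : exists y, dL 2%N y = x - h1 (dL 1%N x).
  apply/exS; rewrite !(linB (dLl 1%N)) h1E qg1 ddS (lin0 f1l) (lin0 h0l).
  by rewrite !subr0 subrr.
have [h2 [h2l h2E]] := free_lift (fL 2%N) l2 (dLl 2%N) lift_h2.
have [H1 [H1l H1E]] := tensor_map (tb 1%N) (tb 2%N) h1l.
have [H2 [H2l H2E]] := tensor_map (tb 2%N) (tb 3%N) h2l.
have bl i x := (tb i).1.1 x.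
have homotopy : forall z, t 2%N (H2 z) + H1 (t 1%N z) = z.
  apply: (tensor_ext (tb 2%N)) => [||x y]; first exact: lin_add (lin_comp _ _) (lin_comp _ _).
    exact: lin_id.
  by rewrite H2E !tb' H1E h2E -(linD (bl 2%N x)) subrK.
have tt : forall z, t 1%N (t 2%N z) = 0.
  apply: (tensor_ext (tb 3%N)) => [||x y]; first exact: lin_comp.
    exact: lin_zero.
  by rewrite !tb' ddS (lin0 (bl _ x)).
move=> y; split=> [ty|[x <-]]; last exact: tt.
by exists (H2 y); rewrite -[RHS]homotopy ty (lin0 H1l) addr0.
Qed.

End Tor.

(** * Diagonal form of matrices over a valuation ring *)

Section DiagonalForm.
Variable R : comNzRingType.
Hypothesis valR : valuation_ring R.

Definition equivalent_mx m n (A B : 'M[R]_(m, n)) : Prop :=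
  exists (P P' : 'M[R]_m) (Q Q' : 'M[R]_n),
    [/\ P *m P' = 1%:M, P' *m P = 1%:M, Q *m Q' = 1%:M, Q' *m Q = 1%:M & A = P *m B *m Q].

(** The diagonal is indexed by [nat], so that one sequence serves both the rows and the columns of a
    rectangular matrix. *)
Definition diag_rect m n (a : nat -> R) : 'M[R]_(m, n) :=
  \matrix_(i, j) (a i *+ (i == j :> nat)).

Lemma equivalent_mx_refl m n (A : 'M[R]_(m, n)) : equivalent_mx A A.
Proof. by exists 1%:M, 1%:M, 1%:M, 1%:M; split; rewrite ?mulmx1 ?mul1mx. Qed.

Lemma equivalent_mx_trans m n (B A C : 'M[R]_(m, n)) :
  equivalent_mx A B -> equivalent_mx B C -> equivalent_mx A C.
Proof.
move=> [P [P' [Q [Q' [h1 h2 h3 h4 ->]]]]] [S [S' [U [U' [k1 k2 k3 k4 ->]]]]].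
exists (P *m S), (S' *m P'), (U *m Q), (Q' *m U').
split; last by rewrite !mulmxA.
- by rewrite mulmxA -[P *m S *m S']mulmxA k1 mulmx1.
- by rewrite mulmxA -[S' *m P' *m P]mulmxA h2 mulmx1.
- by rewrite mulmxA -[U *m Q *m Q']mulmxA h3 mulmx1.
- by rewrite mulmxA -[Q' *m U' *m U]mulmxA k4 mulmx1.
Qed.

Lemma equivalent_mx_pivot m n (A : 'M[R]_(m, n)) i i' j j' :
  equivalent_mx A (xrow i i' (xcol j j' A)).
Proof.
have tt k (x y : 'I_k) : @tperm_mx R k x y *m tperm_mx x y = 1%:M.
  by rewrite -perm_mxM tperm2 perm_mx1.
exists (tperm_mx i i'), (tperm_mx i i'), (tperm_mx j j'), (tperm_mx j j').
split=> //.
by rewrite xrowE xcolE mulmxA mulmxA tt mul1mx -mulmxA tt mulmx1.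
Qed.

Lemma equivalent_mx_block m n (x : 'M[R]_1) (A B : 'M[R]_(m, n)) : equivalent_mx A B ->
  equivalent_mx (block_mx x 0 0 A) (block_mx x 0 0 B).
Proof.
move=> [P [P' [Q [Q' [h1 h2 h3 h4 ->]]]]].
exists (block_mx 1%:M 0 0 P), (block_mx 1%:M 0 0 P'),
  (block_mx 1%:M 0 0 Q), (block_mx 1%:M 0 0 Q').
by split; rewrite !mulmx_block !(mulmx0, mul0mx, mulmx1, mul1mx, addr0, add0r)
  ?h1 ?h2 ?h3 ?h4 -?scalar_mx_block.
Qed.

(** Elimination with a corner entry p that divides its row and column: the multipliers are r and c,
    so no inverse of p enters. *)
Lemma equivalent_mx_clear m n (p : R) (c : 'cV[R]_m) (r : 'rV[R]_n) (B : 'M[R]_(m, n)) :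
  equivalent_mx (block_mx p%:M (p *: r) (p *: c) B) (block_mx p%:M 0 0 (B - p *: (c *m r))).
Proof.
exists (block_mx 1%:M 0 c 1%:M), (block_mx 1%:M 0 (- c) 1%:M),
  (block_mx 1%:M r 0 1%:M), (block_mx 1%:M (- r) 0 1%:M).
split; rewrite !mulmx_block !(mulmx0, mul0mx, mulmx1, mul1mx, addr0, add0r)
  ?(subrr, addNr) -?scalar_mx_block //.
by rewrite mul_scalar_mx mul_mx_scalar -scalemxAl addrC subrK.
Qed.

(** Induction on m: total divisibility supplies an entry dividing all the others, which serves as
    pivot. The sequence is padded with zeros beyond the diagonal. *)
Lemma diagonal_form m n (A : 'M[R]_(m, n)) :
  exists a : nat -> R, (forall i, (minn m n <= i)%N -> a i = 0) /\
    equivalent_mx A (diag_rect m n a).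
Proof.
elim: m n A => [|m IH] n A.
  exists (fun=> 0); split=> //; rewrite [A]flatmx0 [diag_rect _ _ _]flatmx0.
  exact: equivalent_mx_refl.
case: n A => [|n] A.
  exists (fun=> 0); split=> //; rewrite [A]thinmx0 [diag_rect _ _ _]thinmx0.
  exact: equivalent_mx_refl.
have [[i j] /= hij] :=
  common_divisor_fin valR (fun k : 'I_m.+1 * 'I_n.+1 => A k.1 k.2) (ord0, ord0).
pose B : 'M_(1 + m, 1 + n) := xrow i 0 (xcol j 0 A); pose p := A i j.
have dB k l : exists r, B k l = p * r.
  by rewrite !mxE; apply: (hij (tperm i 0 k, tperm j 0 l)).
have [r hr] := choice (fun l : 'I_n => dB 0 (rshift 1 l)).
have [c hc] := choice (fun k : 'I_m => dB (rshift 1 k) 0).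
have BE : B = block_mx p%:M (p *: \row_l r l) (p *: \col_k c k) (drsubmx B).
  rewrite -[LHS]submxK; congr block_mx; apply/matrixP => k l; rewrite !mxE !ord1.
  - by rewrite !lshift0 !tpermR.
  - by rewrite -hr !mxE !lshift0.
  - by rewrite -hc !mxE !lshift0.
have [a [ha eqa]] := IH n (drsubmx B - p *: (\col_k c k *m \row_l r l)).
exists (fun i => if i is k.+1 then a k else p); split.
  by case=> [|k]; rewrite minnSS // ltnS; apply: ha.
apply: equivalent_mx_trans (equivalent_mx_pivot A i 0 j 0) _; rewrite -/B BE.
apply: equivalent_mx_trans (equivalent_mx_clear _ _ _ _) _.
have -> : diag_rect m.+1 n.+1 (fun i => if i is k.+1 then a k else p)
    = block_mx p%:M 0 0 (diag_rect m n a) :> 'M_(1 + m, 1 + n).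
  rewrite -[LHS](@submxK _ 1 m 1 n); congr block_mx; apply/matrixP => k l; rewrite !mxE ?ord1 //.
exact: equivalent_mx_block.
Qed.

Lemma mul_diag_rect m n a (x : 'rV[R]_m) (i : 'I_m) (j : 'I_n) : i = j :> nat ->
  (x *m diag_rect m n a) 0 j = x 0 i * a i.
Proof.
move=> ij; rewrite mxE (bigD1 i) //= big1 ?addr0 => [|k ki]; first by rewrite mxE ij eqxx.
by rewrite mxE -ij (inj_eq val_inj) (negPf ki) mulr0.
Qed.

Lemma mul_diag_rect_geq m n a (x : 'rV[R]_m) (j : 'I_n) : (m <= j)%N ->
  (x *m diag_rect m n a) 0 j = 0.
Proof.
move=> mj; rewrite mxE big1 // => i _; rewrite mxE; case: eqP => [e|]; last by rewrite mulr0.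
by move: mj; rewrite -e leqNgt ltn_ord.
Qed.

Section FullSupport.
Variables (m n : nat) (a : nat -> R).
Hypothesis a0 : forall i, (minn m n <= i)%N -> a i = 0.

(** Rows with i >= n are zero and leave [y 0 i] free, which the padding [a i = 0] encodes. *)
Lemma diag_rect_eq0 (y : 'rV[R]_m) :
  y *m diag_rect m n a = 0 <-> forall i, y 0 i * a i = 0.
Proof.
split=> [h i|h]; last first.
  apply/rowP => j; rewrite [RHS]mxE; case: (ltnP j m) => jm; last exact: mul_diag_rect_geq.
  by rewrite (@mul_diag_rect _ _ a y (Ordinal jm) j).
case: (ltnP i n) => im; last by rewrite a0 ?mulr0 // geq_min im orbT.
by rewrite -(@mul_diag_rect _ _ a y i (Ordinal im)) // h mxE.
Qed.

(** Columns with j >= m receive only 0, and divisibility by the padding [a j = 0] says the same. *)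
Lemma diag_rect_image (z : 'rV[R]_n) :
  (exists x, x *m diag_rect m n a = z) <-> forall j : 'I_n, divides (a j) (z 0 j).
Proof.
split=> [[x <-] j|h].
  case: (ltnP j m) => jm; last first.
    by rewrite mul_diag_rect_geq //; exists 0; rewrite mulr0.
  by exists (x 0 (Ordinal jm)); rewrite (@mul_diag_rect _ _ a x (Ordinal jm) j) // mulrC.
have [r hr] := choice h.
(* Rows without a matching column get coefficient 0. *)
exists (\row_i (if insub (i : nat) is Some j then r j else 0)); apply/rowP => j.
case: (ltnP j m) => jm; last first.
  by rewrite mul_diag_rect_geq // hr a0 ?mul0r // geq_min jm.
by rewrite (@mul_diag_rect _ _ a _ (Ordinal jm) j) // mxE /= valK hr mulrC.
Qed.

End FullSupport.

(** * Diagonal presentations, lambda-dimension and coherence *)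

Lemma lin_mulmxE m n (f : 'rV[R]_m -> 'rV[R]_n) : lin f ->
  forall x, f x = x *m \matrix_i f (delta_mx 0 i).
Proof.
move=> fl x; rewrite {1}[x]row_sum_delta (lin_sum fl) mulmx_sum_row.
by apply: eq_bigr => i _; rewrite rowK (linZ fl).
Qed.

Lemma ann_gen0 : ann_gen (0 : R) 1.
Proof. by move=> x; split=> [_|]; [exists x; rewrite mul1r|rewrite mul0r]. Qed.

(** In coordinates the first two differentials become matrices A and C, and A is diagonalised.
    Exactness at [F 1] shows that (0:a_i) is generated by the i-th entries of the rows of C P, and
    one of these finitely many entries divides the rest. *)
Lemma lambda_ge2_diagonal (E : lmodType R) : lambda_ge E 2 ->
  exists m n (a : nat -> R) (eps : 'rV[R]_n -> E),
    [/\ forall i, (minn m n <= i)%N -> a i = 0,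
        forall i, exists b, ann_gen (a i) b,
        lin eps, forall y, exists x, eps x = y &
        exact_at (fun x : 'rV[R]_m => x *m diag_rect m n a) eps].
Proof.
case=> F [d [eps [fF [dl [el [es [ex0 exS]]]]]]].
have {}ex0 := ex0 isT; have {}exS := exS 0%N isT.
have [n [u0 [u0l u0i u0s]]] := free_coordinates (fF 0%N isT).
have [m [u1 [u1l u1i u1s]]] := free_coordinates (fF 1%N isT).
have [k [u2 [u2l u2i u2s]]] := free_coordinates (fF 2%N isT).
have [v0 [v0l v0K u0K]] := bij_lin_inverse u0l u0i u0s.
have [v1 [v1l v1K u1K]] := bij_lin_inverse u1l u1i u1s.
have /lin_mulmxE := lin_comp v0l (lin_comp (dl 0%N) u1l).
set A := (\matrix_i _) => hA.
have /lin_mulmxE := lin_comp v1l (lin_comp (dl 1%N) u2l).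
set C := (\matrix_i _) => hC.
have dA x : d 0%N (u1 x) = u0 (x *m A) by rewrite -hA u0K.
have dC x : d 1%N (u2 x) = u1 (x *m C) by rewrite -hC u1K.
have [a [ha [P [P' [Q [Q' [PP' P'P QQ' Q'Q AE]]]]]]] := diagonal_form A.
exists m, n, a, (fun y => eps (u0 (y *m Q))); split=> //.
- move=> i; case: (ltnP i m) => im; last first.
    by exists 1; rewrite ha ?geq_min ?im //; apply: ann_gen0.
  pose i' := Ordinal im; pose G := C *m P.
  have Ga l : a i * G l i' = 0.
    have /(diag_rect_eq0 ha) : row l G *m diag_rect m n a = 0.
      have : (delta_mx 0 l : 'rV_k) *m C *m A = 0.
        by apply: u0i; rewrite -dA -dC (lin0 u0l); apply/exS; exists (u2 (delta_mx 0 l)).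
      move/(congr1 (mulmx^~ Q')); rewrite AE mul0mx => <-.
      by rewrite rowE !mulmxA -[RHS]mulmxA QQ' mulmx1.
    by move/(_ i'); rewrite mxE mulrC.
  (* The vector with the single entry y at i lies in the kernel of the diagonal matrix, so it comes
     from [F 2]. *)
  have Gspan y : a i * y = 0 -> exists t : 'rV_k, y = \sum_l t 0 l * G l i'.
    move=> ay; pose x := y *: delta_mx 0 i' : 'rV[R]_m.
    have xD : x *m diag_rect m n a = 0.
      apply/(diag_rect_eq0 ha) => j; rewrite !mxE eqxx /=.
      by case: eqP => [->|_]; rewrite ?mulr1 ?mulr0 ?mul0r // mulrC.
    have /exS [z ez] : d 0%N (u1 (x *m P')) = 0.
      by rewrite dA AE !mulmxA -(mulmxA x) P'P mulmx1 xD mul0mx (lin0 u0l).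
    have [t et] := u2s z; exists t.
    have xG : x = t *m G.
      rewrite /G mulmxA -[x]mulmx1 -P'P mulmxA; congr (_ *m _).
      by apply: u1i; rewrite -ez -et dC.
    by have := congr1 (fun v : 'rV_m => v 0 i') xG; rewrite !mxE !eqxx mulr1.
  (* If [F 2] has rank 0 there is no row to choose from, and the annihilator is 0. *)
  have [[l0]|k0] := pselect (inhabited 'I_k); last first.
    exists 0 => y; split=> [/Gspan [t ->]|[r ->]]; last by rewrite mul0r mulr0.
    by exists 0; rewrite mulr0 big1 // => l; case: k0; exists.
  have [l hl] := common_divisor_fin valR (fun l => G l i') l0.
  exists (G l i') => y; split=> [/Gspan [t ->]|[r ->]]; last by rewrite mulrA Ga mul0r.
  apply: (big_ind (divides (G l i'))) => [||l' _].
  + by exists 0; rewrite mulr0.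
  + by move=> _ _ [r ->] [s ->]; exists (r + s); rewrite mulrDr.
  + by have [r ->] := hl l'; exists (t 0 l' * r); rewrite mulrCA.
- by move=> s x y; rewrite lin_row_mulmx u0l el.
- move=> y; have [x <-] := es y; have [z <-] := u0s x.
  by exists (z *m Q'); rewrite -mulmxA Q'Q mulmx1.
move=> y; split=> [/ex0 [x]|[x <-]].
  have [z <-] := u1s x; rewrite dA => /u0i; rewrite AE => /(congr1 (mulmx^~ Q')).
  by rewrite -!mulmxA QQ' !mulmx1 !mulmxA => <-; exists (z *m P).
apply/ex0; exists (u1 (x *m P')); rewrite dA AE !mulmxA -(mulmxA x) P'P mulmx1 //.
Qed.

Lemma diag_mx_exact m (c c' : nat -> R) : (forall i, ann_gen (c i) (c' i)) ->
  exact_at (fun x : 'rV[R]_m => x *m diag_mx (\row_j c' j))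
    (fun x : 'rV[R]_m => x *m diag_mx (\row_j c j)).
Proof.
move=> cc y; split=> [/rowP h|[x <-]].
  have dv (i : 'I_m) : divides (c' i) (y 0 i).
    by apply/cc; have := h i; rewrite mul_mx_diag !mxE mulrC.
  have [r hr] := choice dv; exists (\row_i r i); apply/rowP => i.
  by rewrite mul_mx_diag !mxE hr mulrC.
apply/rowP => i; rewrite !mul_mx_diag !mxE -mulrA [c' i * c i]mulrC.
by have /cc -> : divides (c' i) (c' i); [exists 1; rewrite mulr1 | rewrite mulr0].
Qed.

Lemma lambda_ge_mono (E : lmodType R) k n : (k <= n)%N -> lambda_ge E n -> lambda_ge E k.
Proof.
move=> kn [F [d [eps [fF [dl [el [es [ex0 exS]]]]]]]].
exists F, d, eps; split; first by move=> i ik; apply/fF/(leq_trans ik).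
do 3![split=> //]; split=> [k0|i ik]; first exact/ex0/(leq_trans k0).
exact/exS/(leq_trans ik).
Qed.

Lemma lambda_ge_cyclic (E : lmodType R) (q : R^o -> E) (b : R) : lin q ->
  (forall y, exists x, q x = y) -> (forall x : R, q x = 0 <-> divides b x) -> lambda_ge E 1.
Proof.
move=> ql qs qb.
(* The presentation is R -> R -> E, starting with multiplication by b; it is continued by zero
   maps. *)
exists (fun=> 'rV[R]_1),
  (fun i => if i is 0%N return 'rV[R]_1 -> 'rV[R]_1 then fun x => b *: x else fun=> 0),
  (fun x : 'rV[R]_1 => q (x 0 0)).
split=> [i _|]; first exact: free_finite_rank_rV.
split; first by case=> [|i] s x y; rewrite ?scaler0 ?addr0 // scalerDr !scalerA mulrC.
split; first by move=> s x y; rewrite !mxE; apply: ql.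
split; first by move=> y; have [x <-] := qs y; exists (x%:M); rewrite mxE mulr1n.
split=> // _ y; split=> [/qb [r hr]|[x <-]]; last by apply/qb; rewrite mxE; exists (x 0 0).
by exists r%:M; apply/rowP => i; rewrite ord1 !mxE mulr1n.
Qed.

Lemma lambda_dim_prop_le k n : (k <= n)%N -> lambda_dim_prop R k -> lambda_dim_prop R n.
Proof. by move=> kn hk E /(lambda_ge_mono kn); apply: hk. Qed.

Variable M : R -> Prop.
Hypothesis maxM : maximal_ideal M.

(** Each a_i has a principal annihilator, and by [ann_gen_next] so do the iterated generators.
    Diagonal matrices of these generators continue the presentation indefinitely. *)
Lemma lambda_dim_prop2 : lambda_dim_prop R 2.
Proof.
move=> E /lambda_ge2_diagonal [m [n [a [eps [ha hann el es ex]]]]] N.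
(* Making existence conditional yields a total function [ann], meaningful where the annihilator is
   principal. *)
have ann_ex (x : R) : exists c, (exists b, ann_gen x b) -> ann_gen x c.
  by case: (pselect (exists b, ann_gen x b)) => [[b hb]|nb]; [exists b|exists 0].
have [ann annP] := choice ann_ex.
pose c k i := iter k ann (a i).
have cann k i : exists b, ann_gen (c k i) b.
  by elim: k => [|k IH]; [apply: hann|apply: (ann_gen_next valR maxM (annP _ IH))].
pose F i : lmodType R := 'rV[R]_(if i is 0%N then n else m).
pose d i := match i return F i.+1 -> F i with
  | 0%N => fun x : 'rV[R]_m => x *m diag_rect m n a
  | k.+1 => fun x : 'rV[R]_m => x *m diag_mx (\row_j c k.+1 j)
  end.
exists F, d, eps.
have exD k : exact_at (fun x : 'rV[R]_m => x *m diag_mx (\row_j c k.+1 j))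
    (fun x : 'rV[R]_m => x *m diag_mx (\row_j c k j)).
  by apply: diag_mx_exact => i; apply/annP/cann.
split=> [i _|]; first exact: free_finite_rank_rV.
split; first by case=> [|i]; apply: lin_row_mulmx.
do 2![split=> //]; split=> // -[|i] _; last exact: exD.
(* The rectangular and the square diagonal matrices on [a] have the same kernel, so exactness at
   [F 1] reduces to the square case. *)
move=> y; rewrite -(exD 0%N y); split=> [/(diag_rect_eq0 ha) h|/rowP h].
  by apply/rowP => i; rewrite mul_mx_diag !mxE h.
by apply/(diag_rect_eq0 ha) => i; move: (h i); rewrite mul_mx_diag !mxE.
Qed.

(** Among finitely many generators of N, one whose image in R divides the other images generates
    alone; so N is cyclic on x0, with relations (0 : j x0). *)
Lemma coherent_of_ann_gen : (forall a : R, exists b, ann_gen a b) -> coherent R.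
Proof.
move=> hann N j jl ji [F [d [eps [fF [_ [el [es _]]]]]]].
have [k [u [ul _ us]]] := free_coordinates (fF 0%N isT).
have [x0 hx0] : exists x0 : N, forall x, exists r, x = r *: x0.
  have span x : exists t : 'rV[R]_k, x = \sum_i t 0 i *: eps (u (delta_mx 0 i)).
    have [y <-] := es x; have [t <-] := us y; exists t.
    rewrite {1}[t]row_sum_delta (lin_sum ul) (lin_sum el).
    by apply: eq_bigr => i _; rewrite (linZ ul) (linZ el).
  have [[i0]|k0] := pselect (inhabited 'I_k); last first.
    exists 0 => x; exists 0; have [t ->] := span x.
    by rewrite scaler0 big1 // => i; case: k0; exists.
  have [i hi] := common_divisor_fin valR (fun i => j (eps (u (delta_mx 0 i)))) i0.
  exists (eps (u (delta_mx 0 i))) => x; have [t ->] := span x.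
  apply: (big_ind (fun x => exists r, x = r *: _)) => [||l _].
  - by exists 0; rewrite scale0r.
  - by move=> _ _ [r ->] [s ->]; exists (r + s); rewrite scalerDl.
  have [r hr] := hi l; exists (t 0 l * r); rewrite -scalerA; congr (_ *: _).
  by apply: ji; rewrite hr (linZ jl) /= mulrC.
have [b hb] := hann (j x0).
apply: (@lambda_ge_cyclic N (fun r => r *: x0) b) => [s x y|y|x].
- by rewrite scalerDl scalerA.
- by have [r ->] := hx0 y; exists r.
rewrite -hb; split=> h; last by apply: ji; rewrite (linZ jl) (lin0 jl) -h mulrC.
by rewrite mulrC -[x * _]/(x *: (j x0 : R^o)) -(linZ jl) h (lin0 jl).
Qed.

(** R/aR has lambda at least 1. With lambda at least 2, it would have a diagonal presentation with
    regular entries; their product is regular and annihilates the module, hence is a multiple of the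
    zero divisor a, a contradiction. *)
Lemma not_lambda_dim_prop1 (a b s : R) : a != 0 -> b != 0 -> a * b = 0 ->
  M s -> regular s -> ~ lambda_dim_prop R 1.
Proof.
move=> a0 b0 ab Ms rs h1.
have [|E [q [ql qs qa]]] := @quotient_module R R^o (divides a).
  have [D0 [DD DM]] := is_ideal_divides a.
  by split=> //.
have /h1 /(_ 2%N) := lambda_ge_cyclic ql qs qa.
case/lambda_ge2_diagonal => m [n [c [eps [hc cann el es ex]]]].
have killP r : divides a r <-> forall y : E, r *: y = 0.
  split=> [[t ->] y|h].
    have [x <-] := qs y; rewrite -(linZ ql); apply/qa; exists (t * x); exact: esym (mulrA a t x).
  by apply/qa; rewrite -[r]mulr1 -[r * 1]/(r *: (1 : R^o)) (linZ ql) h.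
(* Since a kills E, each c_j divides a and is therefore nonzero. *)
have cdiv (j : 'I_n) : divides (c j) a.
  have /ex /(diag_rect_image hc) /(_ j) : eps (a *: delta_mx 0 j) = 0.
    by rewrite (linZ el); apply: (killP a).1; exists 1; rewrite mulr1.
  by rewrite !mxE !eqxx mulr1.
have creg (j : 'I_n) : regular (c j).
  have [e he] := cann j; apply: (regular_ann_gen valR maxM Ms rs he).
  by apply/eqP => c0; have [r] := cdiv j; rewrite c0 mul0r => ea; rewrite ea eqxx in a0.
have /killP [t et] : forall y : E, (\prod_(j < n) c j) *: y = 0.
  move=> y; have [x <-] := es y; rewrite -(linZ el); apply/ex/(diag_rect_image hc) => j.
  by rewrite mxE (bigD1 j) //= -mulrA; eexists.
have preg : regular (\prod_(j < n) c j).
  apply: (big_ind regular) => [x|x y rx ry z|j _]; last exact: creg.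
    by rewrite mul1r.
  by rewrite -mulrA => /rx /ry.
by move: b0; rewrite (preg b) ?eqxx // et mulrAC ab mul0r.
Qed.

(** The projection keeping the coordinates with a_i nonzero, hence regular, does not change the
    diagonal map and vanishes on its kernel, as [tor2_vanish] requires. *)
Lemma flat_dim_le1 (E : lmodType R) :
  (forall a b : R, ann_gen a b -> a = 0 \/ regular a) -> lambda_ge E 2 -> flat_dim_le E 1.
Proof.
move=> hreg /lambda_ge2_diagonal [m [n [a [eps [ha hann el es ex]]]]].
exists 1%N; split=> // F.
have fr k : is_free 'rV[R]_k := free_finite_rank_free (free_finite_rank_rV R k).
apply: (@tor2_vanish _ E _ _ _ _
  (fun x : 'rV[R]_m => x *m diag_mx (\row_i (a i != 0)%:R)) (fr n) (fr m) _ el _ es ex).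
- exact: lin_row_mulmx.
- exact: lin_row_mulmx.
- move=> x; apply/eqP; rewrite -subr_eq0 -mulmxBl; apply/eqP/(diag_rect_eq0 ha) => i.
  rewrite mul_mx_diag !mxE; case: eqP => [->|_]; first by rewrite mulr0.
  by rewrite mulr1 subrr mul0r.
- move=> x /(diag_rect_eq0 ha) xa; apply/rowP => i; rewrite mul_mx_diag !mxE.
  case: eqP => [_|a0]; first by rewrite mulr0.
  have [b /hreg [//|ra]] := hann i.
  by rewrite (ra (x 0 i)) ?mul0r // mulrC.
Qed.

End DiagonalForm.

(** * Flatness of uniserial modules and of the maximal ideal *)

Section Flat.
Variable R : comNzRingType.
Hypothesis valR : valuation_ring R.

(** Over a valuation ring this is equivalent to the total ordering of cyclic submodules; a common
    generator z is what tensor computations use. *)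
Definition uniserial (N : lmodType R) : Prop :=
  forall x y : N, exists z r s, x = r *: z /\ y = s *: z.

Section Uniserial.
Variable N : lmodType R.
Hypothesis uniN : uniserial N.

(** With a common generator z of x and x', a sum of two pure tensors is again pure. So pure tensors
    form a submodule, and the quotient map by it agrees with 0 on all of them. *)
Lemma tensor_pure (A T : lmodType R) (b : A -> N -> T) : is_tensor b ->
  forall t, exists a x, t = b a x.
Proof.
move=> tb; have [[bl br] _] := tb.
have [|W [q [ql _ qS]]] := @quotient_module R T (fun t => exists a x, t = b a x).
  split=> [|_ _ [a [x ->]] [a' [x' ->]]|s _ [a [x ->]]].
  - by exists 0, 0; rewrite (lin0 (bl 0)).
  - have [z [r [s [-> ->]]]] := uniN x x'; exists (r *: a + s *: a'), z.
    by rewrite (br z) (linZ (br z)) !(linZ (bl _)).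
  - by exists (s *: a), x; rewrite (linZ (br x)).
move=> t; apply/qS; apply: (tensor_ext tb ql (@lin_zero _ _ _)) => a x.
by apply/qS; exists a, x.
Qed.

(* [B (x) N] is the direct limit of the modules [B / (0:y)B] over [y : N]; it is
   realised here by functions [N -> B] modulo those that are eventually in
   [(0:y)B]. *)
Lemma tensor_eq0 (B T : lmodType R) (b : B -> N -> T) v x : is_tensor b -> b v x = 0 ->
  exists y r z v', [/\ x = r *: y, z *: y = 0 & r *: v = z *: v'].
Proof.
move=> [_ ub] bvx.
(* An index y is larger when it generates a larger submodule, so a tail consists of all y having a
   fixed y0 as a multiple. *)
pose S (f : N -> B) := exists y0, forall y, (exists s, y0 = s *: y) ->
  exists z v', z *: y = 0 /\ f y = z *: v'.
have [|W [q [ql _ qS]]] := @quotient_module R (N -> B) S.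
  split=> [|f g [y1 h1] [y2 h2]|s f [y1 h1]].
  - by exists 0 => y _; exists 0, 0; rewrite !scale0r.
  - have [y0 [r1 [r2 [e1 e2]]]] := uniN y1 y2; exists y0 => y [s es].
    have [|z1 [v1 [zy1 fv]]] := h1 y; first by exists (r1 * s); rewrite e1 es scalerA.
    have [|z2 [v2 [zy2 gv]]] := h2 y; first by exists (r2 * s); rewrite e2 es scalerA.
    rewrite -[(f + g) y]/(f y + g y) fv gv.
    case: (divides_total valR z1 z2) => [[w ->]|[w ->]].
      by exists z1, (v1 + w *: v2); rewrite scalerDr scalerA.
    by exists z2, (w *: v1 + v2); rewrite scalerDr scalerA.
  - exists y1 => y /h1 [z [v1 [zy fv]]]; exists z, (s *: v1); split=> //.
    by rewrite -[(s *: f) y]/(s *: f y) fv !scalerA mulrC.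
(* [quo (x, y)] will be a chosen ratio x/y, meaningful when x is a multiple of y. *)
have quo_ex (p : N * N) : exists r, (exists r, p.1 = r *: p.2) -> p.1 = r *: p.2.
  by case: (pselect (exists r, p.1 = r *: p.2)) => [[r hr]|nr]; [exists r|exists 0].
have [quo quoP] := choice quo_ex.
(* The tensor of w and x' is sent to y -> (x'/y) w. Two ratios over y differ by an element of (0:y),
   which gives linearity in x' modulo [S]. *)
pose h w x' := q (fun y => quo (x', y) *: w).
have hb : bilin h.
  split=> [w s x1 x2|x1 s w1 w2]; rewrite /h -ql; last first.
    by congr q; apply/funext => y; rewrite scalerDr scalerA mulrC -scalerA.
  apply/eqP; rewrite -subr_eq0 -(linB ql); apply/eqP/qS.
  have [y0 [r1 [r2 [e1 e2]]]] := uniN x1 x2; exists y0 => y [t et].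
  have {}e1 : x1 = quo (x1, y) *: y.
    by apply: (quoP (x1, y)); exists (r1 * t); rewrite /= e1 et scalerA.
  have {}e2 : x2 = quo (x2, y) *: y.
    by apply: (quoP (x2, y)); exists (r2 * t); rewrite /= e2 et scalerA.
  have e3 : s *: x1 + x2 = quo (s *: x1 + x2, y) *: y.
    apply: (quoP (s *: x1 + x2, y)); exists (s * quo (x1, y) + quo (x2, y)).
    by rewrite scalerDl -scalerA -e1 -e2.
  exists (quo (s *: x1 + x2, y) - (s * quo (x1, y) + quo (x2, y))), w; split.
    by rewrite scalerBl scalerDl -scalerA -e1 -e2 -e3 subrr.
  by rewrite scalerBl scalerDl -scalerA.
have [[u [ul ubE]] _] := ub _ _ hb.
have /qS [y0 hy0] : h v x = 0 by rewrite -ubE bvx (lin0 ul).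
(* This y lies in the tail of y0 and also has x as a multiple, so the ratio x/y is genuine. *)
have [y [s [r [e0 ex]]]] := uniN y0 x.
have [|z [v' [zy e]]] := hy0 y; first by exists s.
exists y, (quo (x, y)), z, v'; split=> //.
by apply: (quoP (x, y)); exists r.
Qed.

(** If f(a) tensor x vanishes, then x = r y with z y = 0 and r f(a) = z v'. Writing y = t y' with z
    t = 0 gives f(r t a) = 0, so a tensor x, which is (r t a) tensor y', vanishes. *)
Lemma uniserial_flat :
  (forall z (y : N), z *: y = 0 -> exists t y', y = t *: y' /\ z * t = 0) -> flat N.
Proof.
move=> key A B f fl fi TA TB bA bB tA tB g gl gE t1 t2 g12.
apply/eqP; rewrite -subr_eq0; apply/eqP.
have : g (t1 - t2) = 0 by rewrite (linB gl) g12 subrr.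
have [a [x ->]] := tensor_pure tA (t1 - t2); rewrite gE.
case/(tensor_eq0 tB) => y [r [z [v' [-> /key [t [y' [-> zt]]] e]]]].
have [[bl br] _] := tA.
rewrite scalerA (linZ (bl a)) -(linZ (br y')).
have -> : (r * t) *: a = 0; last exact: (lin0 (br y')).
apply: fi; rewrite (linZ fl) (lin0 fl) mulrC -scalerA e scalerA mulrC zt.
exact: scale0r.
Qed.

End Uniserial.

Lemma flat_maximal_ideal (M : R -> Prop) : maximal_ideal M ->
  (forall a b : R, ann_gen a b -> a = 0 \/ regular a) -> flat_ideal M.
Proof.
move=> maxM hreg N j jl ji jM.
have uniN : uniserial N.
  move=> x y; case: (divides_total valR (j x) (j y)) => -[r e].
    exists x, 1, r; rewrite scale1r; split=> //.
    by apply: ji; rewrite (linZ jl) e; apply: mulrC.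
  exists y, r, 1; rewrite scale1r; split=> //.
  by apply: ji; rewrite (linZ jl) e; apply: mulrC.
apply: (uniserial_flat uniN) => z y zy.
case: (eqVneq z 0) => [->|z0]; first by exists 1, y; rewrite scale1r mul0r.
case: (eqVneq y 0) => [->|y0]; first by exists 0, 0; rewrite scale0r mulr0.
have zjy : z * j y = 0 by rewrite -[LHS]/(z *: j y) -(linZ jl) zy (lin0 jl).
(* Otherwise j y would generate (0:z), and z would be 0 or regular; both are excluded, as z and y
   are nonzero. *)
have [x [zx ndx]] : exists x, z * x = 0 /\ ~ divides (j y) x.
  apply: contrapT => h.
  have /hreg [e|rz] : ann_gen z (j y).
  - move=> x; split=> [zx|[r ->]]; last by rewrite mulrA zjy mul0r.
    by apply: contrapT => ndx; apply: h; exists x.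
  - by rewrite e eqxx in z0.
  - by move/eqP: y0; apply; apply: ji; rewrite (lin0 jl); apply: rz.
case: (divides_total valR (j y) x) => // -[w ew].
(* A unit w would make x a multiple of j y, so w lies in M, the image of j. *)
have [y' ey'] : exists y', j y' = w.
  apply/jM; apply: contrapT => /(nonunit_maximal valR maxM) [w' ww].
  by apply: ndx; exists w'; rewrite ew -mulrA ww mulr1.
by exists x, y'; split=> //; apply: ji; rewrite (linZ jl) ew ey'.
Qed.

End Flat.

(** * Zero divisors and the four assertions *)

Section Consequences.
Variables (R : comNzRingType) (M : R -> Prop).
Hypotheses (valR : valuation_ring R) (maxM : maximal_ideal M).

Lemma regularPn (a : R) : ~ regular a -> zero_divisor a.
Proof.
move=> nr; apply: contrapT => nz; apply: nr => x ax; apply/eqP.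
by apply: contrapT => /negP x0; apply: nz; exists x.
Qed.

Lemma zero_divisor_maximal (a : R) : zero_divisor a -> M a.
Proof.
case=> b [b0 ab]; apply: contrapT => /(nonunit_maximal valR maxM) [c ac].
by move: b0; rewrite -[b]mul1r -ac mulrAC ab mul0r eqxx.
Qed.

Lemma domain_ann_gen : is_domain R -> forall a : R, exists b, ann_gen a b.
Proof.
move=> dom a; case: (eqVneq a 0) => [->|a0]; first by exists 1; apply: ann_gen0.
exists 0 => x; split=> [/dom [a0'|->]|[r ->]]; last by rewrite mul0r mulr0.
  by rewrite a0' eqxx in a0.
by exists 0; rewrite mulr0.
Qed.

(** In the noncoherent case, nonzero a and b would make every annihilator principal and hence R
    coherent; so b = 0. *)
Lemma ann_gen_regular : is_domain R \/ ~ coherent R ->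
  forall a b : R, ann_gen a b -> a = 0 \/ regular a.
Proof.
move=> h a b ab; case: (eqVneq a 0) => [|a0]; first by left.
right; case: h => [dom x /dom [a0'|//]|nc]; first by rewrite a0' eqxx in a0.
case: (eqVneq b 0) => [b0|b0]; first by move=> x /ab [r ->]; rewrite b0 mul0r.
by case: nc; apply: coherent_of_ann_gen => //; apply: (ann_gen_all valR maxM ab).
Qed.

End Consequences.

Theorem theorem2p11 (R : comNzRingType) (M : R -> Prop) :
  valuation_ring R -> maximal_ideal M ->
  [/\ ((forall a : R, zero_divisor a <-> a = 0) -> coherent R),
      (~ (forall a : R, zero_divisor a <-> a = 0) ->
       ~ (forall a : R, zero_divisor a <-> M a) -> lambda_dim_eq R 2),
      (~ (forall a : R, zero_divisor a <-> a = 0) ->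
       (forall a : R, zero_divisor a <-> M a) -> lambda_dim_le R 2) &
      (is_domain R \/ ~ coherent R ->
       flat_ideal M /\
       forall E : lmodType R, lambda_infinite E -> flat_dim_le E 1)].
Proof.
move=> valR maxM; have prop2 := lambda_dim_prop2 valR maxM; split.
- move=> Z0; apply/coherent_of_ann_gen/domain_ann_gen => // a b ab.
  case: (eqVneq b 0) => [|b0]; first by right.
  by left; apply/Z0; exists b.
- move=> nZ0 nZM; split=> // m m2 hm.
  have [a [a0 [b [b0 ab]]]] : exists a : R, a != 0 /\ zero_divisor a.
    apply: contrapT => h; apply: nZ0 => a; split=> [za|->].
      by apply/eqP; apply: contrapT => /negP a0; apply: h; exists a.
    by exists 1; rewrite oner_neq0 mul0r.
  (* All zero divisors lie in M, so Z can differ from M only by a regular element of M. *)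
  have [s [Ms rs]] : exists s, M s /\ regular s.
    apply: contrapT => h; apply: nZM => c; split; first exact: zero_divisor_maximal.
    by move=> Ma; apply: regularPn => ra; apply: h; exists c.
  apply: (not_lambda_dim_prop1 valR maxM a0 b0 ab Ms rs).
  exact: lambda_dim_prop_le hm.
- by move=> _ _; exists 2%N.
- move=> h; have hreg := ann_gen_regular valR maxM h.
  split; first exact: flat_maximal_ideal.
  by move=> E /(_ 2%N); apply: flat_dim_le1.
Qed.
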